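(* Let $P$ be a simple planar polygon (vertices in general position), and suppose the pairwise noncrossing diagonals $\mathcal{D}=\{d_1,\ldots,d_k\}$ of $P$ divide $P$ into polygons $Q_0,\ldots,Q_k$. Then $\mathcal{K}_P(\mathcal{D})$ is isomorphic to the cartesian product $\mathcal{K}_{Q_0}\times\cdots\times\mathcal{K}_{Q_k}$.
   Context: A diagonal of a polygon is a line segment connecting two of its vertices contained in its interior. A convex diagonalization of a polygon $R$ is a partition of $R$ into convex polygons by pairwise noncrossing diagonals; $\pi(R)$ is the poset of these with $a\prec a'$ if $a$ is obtained from $a'$ by adding diagonals. For a simple polygon $R$, $\mathcal{K}_R$ is a polytopal complex whose face poset is isomorphic to $\pi(R)$ (the subcomplex of the associahedron $\mathcal{K}_m$, $m$ the number of vertices of $R$, consisting of faces corresponding to convex diagonalizations of $R$). $\mathcal{K}_P(\mathcal{D})$ denotes the collection of faces of $\mathcal{K}_P$ corresponding to convex diagonalizations of $P$ that contain $\mathcal{D}$. *)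

(* Defs.v *)
From HB Require Import structures.
From mathcomp Require Import all_boot all_order all_algebra.
From mathcomp Require Import all_classical all_reals all_analysis.

Set Implicit Arguments.
Unset Strict Implicit.
Unset Printing Implicit Defensive.

Import Order.TTheory GRing.Theory Num.Theory.
Import numFieldNormedType.Exports.

Local Open Scope classical_set_scope.
Local Open Scope ring_scope.

Section Polygons.
Variable R : realType.
Local Notation plane := 'rV[R]_2.

Definition segment (a b : plane) : set plane :=
  [set (1 - t) *: a + t *: b | t in `[0, 1]].

Definition open_segment (a b : plane) : set plane :=
  [set (1 - t) *: a + t *: b | t in `]0, 1[].

Definition collinear (a b c : plane) : Prop :=
  (b 0 0 - a 0 0) * (c 0 1 - a 0 1) = (c 0 0 - a 0 0) * (b 0 1 - a 0 1).

(* A polygon with n vertices is given by its cyclic sequence of vertices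
   p : 'I_n -> plane; the cyclic successor of an index is ordS. *)

Definition edge n (p : 'I_n -> plane) (i : 'I_n) : set plane :=
  segment (p i) (p (ordS i)).

Definition simple_polygon n (p : 'I_n -> plane) : Prop :=
  [/\ (3 <= n)%N, injective p &
      forall i j, i != j -> edge p i `&` edge p j `<=`
        [set p i; p (ordS i)] `&` [set p j; p (ordS j)]].

Definition general_position n (p : 'I_n -> plane) : Prop :=
  forall i j k, i != j -> j != k -> i != k -> ~ collinear (p i) (p j) (p k).

Definition boundary n (p : 'I_n -> plane) : set plane :=
  \bigcup_(i in [set: 'I_n]) edge p i.

(* The bounded part of the complement of the boundary curve. *)
Definition polygon_interior n (p : 'I_n -> plane) : set plane :=
  [set x | (~` boundary p) x /\
           bounded_set (connected_component (~` boundary p) x)].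

(* A diagonal is a segment of the plane, rather than a pair of indices, so that
   diagonals of a polygon and of its pieces can be compared directly. *)
Definition diagonal n (p : 'I_n -> plane) (d : set plane) : Prop :=
  exists i j, d = segment (p i) (p j) /\
    open_segment (p i) (p j) `<=` polygon_interior p.

Definition noncrossing n (p : 'I_n -> plane) (d d' : set plane) : Prop :=
  d `&` d' `<=` range p.

Definition noncrossing_diagonals n (p : 'I_n -> plane) (D : set (set plane)) :
    Prop :=
  (forall d, D d -> diagonal p d) /\
  (forall d d', D d -> D d' -> d <> d' -> noncrossing p d d').

(* The interiors of the polygons into which the diagonals in D cut p. *)
Definition pieces n (p : 'I_n -> plane) (D : set (set plane)) :
    set (set plane) :=
  let U := polygon_interior p `\` \bigcup_(d in D) d in
  [set connected_component U x | x in U].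

(* The polygon with interior C is the closure of C. *)
Definition convex_diagonalization n (p : 'I_n -> plane) (a : set (set plane)) :
    Prop :=
  noncrossing_diagonals p a /\
  (forall C, pieces p a C -> convex_set (closure C)).

Definition divides n (p : 'I_n -> plane) (D : set (set plane))
    k (m : 'I_k -> nat) (Q : forall i, 'I_(m i) -> plane) : Prop :=
  [/\ forall i, simple_polygon (Q i),
      forall i j, range p (Q i j),
      forall i j, range (edge p) (edge (Q i) j) \/ D (edge (Q i) j) &
      set_bij [set: 'I_k] (pieces p D) (fun i => polygon_interior (Q i))].

End Polygons.

Section Complexes.
Variable R : realType.

(* Polytopes and faces are nonempty: the face posets considered here do not
   contain the empty face. *)

Definition polytope N (X : set 'rV[R]_N) : Prop :=
  exists n (v : 'I_n.+1 -> 'rV[R]_N),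
    X = [set x | exists l : 'I_n.+1 -> R,
           [/\ forall j, 0 <= l j, \sum_j l j = 1 & x = \sum_j l j *: v j]].

Definition face N (X F : set 'rV[R]_N) : Prop :=
  F !=set0 /\
  exists (c : 'rV[R]_N) (b : R),
    (forall x, X x -> \sum_i c 0 i * x 0 i <= b) /\
    F = X `&` [set x | \sum_i c 0 i * x 0 i = b].

Definition polytopal_complex N (K : set (set 'rV[R]_N)) : Prop :=
  [/\ finite_set K,
      forall X, K X -> polytope X,
      forall X F, K X -> face X F -> K F &
      forall X Y, K X -> K Y -> X `&` Y !=set0 ->
        face X (X `&` Y) /\ face Y (X `&` Y)].

(* K is a polytopal complex whose face poset is identified by lab with the
   poset of convex diagonalizations of p, in which adding diagonals goes down. *)
Definition diagonalization_complex n (p : 'I_n -> 'rV[R]_2) N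
    (K : set (set 'rV[R]_N)) (lab : set 'rV[R]_N -> set (set 'rV[R]_2)) : Prop :=
  [/\ polytopal_complex K,
      set_bij K [set a | convex_diagonalization p a] lab &
      forall F G, K F -> K G -> (F `<=` G <-> lab G `<=` lab F)].

Definition faces_containing N (K : set (set 'rV[R]_N))
    (lab : set 'rV[R]_N -> set (set 'rV[R]_2)) (D : set (set 'rV[R]_2)) :
    set (set 'rV[R]_N) :=
  [set F | K F /\ D `<=` lab F].

Definition product_complex k (N : 'I_k -> nat)
    (K : forall i, set (set 'rV[R]_(N i))) :
    set (set (forall i, 'rV[R]_(N i))) :=
  [set X | exists F : forall i, set 'rV[R]_(N i),
     (forall i, K i (F i)) /\ X = [set x | forall i, F i (x i)]].

Definition isomorphic_complexes (T U : Type) (K : set (set T))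
    (L : set (set U)) : Prop :=
  exists f : set T -> set U, set_bij K L f /\
    forall F G, K F -> K G -> (F `<=` G <-> f F `<=` f G).

End Complexes.

(* Main.v *)
(** A convex diagonalization [b] of [p] containing [D] is cut into the families
    [b_i] of its members that are diagonals of [Q i], and is recovered as the
    union of [D] and the [b_i].  The open part of a diagonal in [b \ D] is
    connected and avoids [D], so it lies in the interior of a single [Q i]; its
    endpoints are vertices of [p] that are not interior to [Q i], hence they lie
    on the boundary of [Q i], and are then vertices of [Q i].  The connected
    components left by the union of [D] and the [b_i] are exactly those left by
    each [b_i] in [Q i], so convexity can be tested piece by piece.  The order
    on boxes is the product order because faces are nonempty. *)

From mathcomp Require Import lra.
From mathcomp Require Import all_boot all_order all_algebra.
From mathcomp Require Import all_classical all_reals all_analysis.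
Require Import Defs.

Set Implicit Arguments.
Unset Strict Implicit.
Unset Printing Implicit Defensive.

Import Order.TTheory GRing.Theory Num.Theory.
Import numFieldNormedType.Exports.

Local Open Scope classical_set_scope.
Local Open Scope ring_scope.

Section ConnectedComponents.
Context {T : topologicalType}.
Implicit Types (A B : set T) (x : T).

Lemma connected_componentS A B x :
  A `<=` B -> connected_component A x `<=` connected_component B x.
Proof.
move=> AB; apply: bigcup_subset => C [Cx CA Cc].
by split=> //; exact: subset_trans CA AB.
Qed.

Lemma connected_componentI A B x : A `<=` B ->
  connected_component (A `&` connected_component B x) x =
  connected_component A x.
Proof.
move=> AB; apply/seteqP; split.
  by apply: connected_componentS; exact: subIsetl.
apply: bigcup_subset => C [Cx CA Cc]; split=> //; rewrite subsetI; split=> //.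
by apply: connected_component_max => //; exact: subset_trans CA AB.
Qed.

End ConnectedComponents.

Definition affine_path {R : pzRingType} {V : lmodType R} (a b : V) (t : R) :
    V :=
  (1 - t) *: a + t *: b.

Section AffinePath.
Context {R : pzRingType} {V : lmodType R}.
Implicit Types (a b : V) (s t u : R).

Lemma affine_path0 a b : affine_path a b 0 = a.
Proof. by rewrite /affine_path subr0 scale1r scale0r addr0. Qed.

Lemma affine_path1 a b : affine_path a b 1 = b.
Proof. by rewrite /affine_path subrr scale1r scale0r add0r. Qed.

Lemma affine_pathE a b t : affine_path a b t = a + t *: (b - a).
Proof. by rewrite /affine_path scalerBl scale1r scalerBr addrAC addrA. Qed.

Lemma affine_pathxx a t : affine_path a a t = a.
Proof. by rewrite affine_pathE subrr scaler0 addr0. Qed.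

Lemma affine_pathC a b t : affine_path a b (1 - t) = affine_path b a t.
Proof. by rewrite /affine_path subKr addrC. Qed.

Lemma sub_image_affine_pathC a b (A B : set R) :
  (forall t, A t -> B (1 - t)) ->
  affine_path a b @` A `<=` affine_path b a @` B.
Proof.
by move=> AB x [t At <-]; exists (1 - t); [exact: AB|exact: affine_pathC].
Qed.

Lemma affine_path_affine_path a b s u t :
  affine_path (affine_path a b s) (affine_path a b u) t =
  affine_path a b ((1 - t) * s + t * u).
Proof.
rewrite !affine_pathE opprD addrACA subrr add0r -scalerBl scalerA -addrA.
by rewrite -scalerDl mulrBl mul1r mulrBr addrA addrAC.
Qed.

End AffinePath.

Lemma affine_path_eq_left (K : fieldType) (V : lmodType K) (a b : V) (t : K) :
  affine_path a b t = a -> t = 0 \/ a = b.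
Proof.
rewrite affine_pathE => /eqP; rewrite -subr_eq0 addrAC subrr add0r.
by rewrite scaler_eq0 subr_eq0 => /orP[]/eqP ->; [left|right].
Qed.

Lemma continuous_affine_path (R : realFieldType) (V : normedModType R)
  (a b : V) : continuous (affine_path a b).
Proof.
move=> t; apply: cvgD; last by apply: cvgZr_tmp; exact: cvg_id.
by apply: cvgZr_tmp; apply: cvgB; [exact: cvg_cst|exact: cvg_id].
Qed.

Lemma connected_affine_path (R : realType) (V : normedModType R) (a b : V)
  (i : interval R) : connected (affine_path a b @` [set` i]).
Proof.
apply: connected_continuous_connected.
  exact/connected_intervalP/interval_is_interval.
exact/continuous_subspaceT/continuous_affine_path.
Qed.

Section Segments.
Context {R : realType}.
Implicit Types a b c d x y : 'rV[R]_2.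

Lemma open_segment_sub_segment a b : open_segment a b `<=` segment a b.
Proof. by apply: image_subset; apply: subset_itvW. Qed.

Lemma segment_left a b : segment a b a.
Proof. by exists 0; [rewrite /= in_itv/= lexx ler01|exact: affine_path0]. Qed.

Lemma segmentC a b : segment a b = segment b a.
Proof.
by apply/seteqP; split; apply: sub_image_affine_pathC => t;
  rewrite /= !in_itv/=; lra.
Qed.

Lemma open_segmentC a b : open_segment a b = open_segment b a.
Proof.
by apply/seteqP; split; apply: sub_image_affine_pathC => t;
  rewrite /= !in_itv/=; lra.
Qed.

Lemma open_segment_nonempty a b : open_segment a b !=set0.
Proof.
by exists (affine_path a b 2^-1); exists 2^-1 => //=; rewrite in_itv/=; lra.
Qed.

Lemma half_open_segmentE a b :
  affine_path a b @` `[0, 1[ = a |` open_segment a b.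
Proof.
by rewrite -(setU1itv false) ?bnd_simp// image_setU image_set1 affine_path0.
Qed.

Lemma connected_half_open_segment a b : connected (a |` open_segment a b).
Proof. by rewrite -half_open_segmentE; exact: connected_affine_path. Qed.

Lemma connected_open_segment a b : connected (open_segment a b).
Proof. exact: connected_affine_path. Qed.

Lemma segmentE a b : segment a b = [set a; b] `|` open_segment a b.
Proof.
transitivity (affine_path a b @` (`[0, 1[ `|` [set 1])).
  by rewrite setUitv1 ?bnd_simp.
by rewrite image_setU image_set1 affine_path1 half_open_segmentE setUAC.
Qed.

Lemma segment_left_extreme a b x y :
  segment a b x -> segment a b y -> open_segment x y a -> x = a.
Proof.
case=> s /=; rewrite in_itv/= => /andP[s0 _] xE.
case=> u /=; rewrite in_itv/= => /andP[u0 _] yE.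
case=> t /=; rewrite in_itv/= => /andP[t0 t1].
rewrite -[LHS]/(affine_path x y t) -xE -yE => aE.
have [/eqP|<-] := affine_path_eq_left
  (etrans (esym (affine_path_affine_path a b s u t)) aE); last first.
  exact: affine_pathxx.
rewrite paddr_eq0 ?mulr_ge0 ?subr_ge0 ?(ltW t0) ?(ltW t1)//.
rewrite mulf_eq0 subr_eq0 gt_eqF//= => /andP[/eqP -> _].
exact: affine_path0.
Qed.

Lemma segment_eq_left a b c d : segment a b = segment c d -> [set a; b] c.
Proof.
move=> abcd; have : segment a b c by rewrite abcd; exact: segment_left.
rewrite segmentE => -[//|c_between]; left; apply/esym.
apply: (segment_left_extreme (b := d)) c_between; rewrite -abcd.
  exact: segment_left.
by rewrite segmentC; exact: segment_left.
Qed.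

Lemma segment_eq_endpoints a b c d :
  segment a b = segment c d -> [set a; b] = [set c; d].
Proof.
move=> abcd; apply/seteqP; split=> _ [] ->.
- exact: segment_eq_left (esym abcd).
- by apply: (@segment_eq_left _ _ b a); rewrite -abcd segmentC.
- exact: segment_eq_left abcd.
- by apply: (@segment_eq_left _ _ d c); rewrite abcd segmentC.
Qed.

End Segments.

Section Polygon.
Context {R : realType} {n : nat}.
Variable p : 'I_n -> 'rV[R]_2.
Implicit Types A d e : set 'rV[R]_2.

Lemma polygon_interior_not_vertex x : polygon_interior p x -> ~ range p x.
Proof.
case=> px _ [i _ ix]; apply: px; exists i => //.
by rewrite -ix; exact: segment_left.
Qed.

Lemma connected_sub_polygon_interior A : connected A -> A `<=` ~` boundary p ->
  A `&` polygon_interior p !=set0 -> A `<=` polygon_interior p.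
Proof.
move=> Ac Ap [x [Ax [_ bx]]] y Ay; split; first exact: Ap.
by rewrite -(same_connected_component (connected_component_max Ax Ap Ac Ay)).
Qed.

Lemma open_segment_interior_left a b :
  open_segment a b `<=` polygon_interior p ->
  (polygon_interior p `|` boundary p) a.
Proof.
move=> ab; have [|pa] := pselect (boundary p a); [by right|left].
apply: (connected_sub_polygon_interior (@connected_half_open_segment _ a b)).
- by move=> x [->//|/ab[]].
- have [x xab] := open_segment_nonempty a b.
  by exists x; split; [right|exact: ab].
- by left.
Qed.

Lemma edge_vertex i j :
  simple_polygon p -> edge p i (p j) -> [set p i; p (ordS i)] (p j).
Proof.
case=> _ _ edgesI pij; have [->|ij] := eqVneq i j; first by left.
by have [] := edgesI i j ij (p j) (conj pij (segment_left _ _)).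
Qed.

Lemma diagonal_vertex i j l :
  open_segment (p i) (p j) `<=` polygon_interior p ->
  segment (p i) (p j) (p l) -> [set p i; p j] (p l).
Proof.
move=> ijp; rewrite segmentE => -[//|/ijp/polygon_interior_not_vertex[]].
by exists l.
Qed.

Lemma diagonal_sub e : diagonal p e -> e `<=` polygon_interior p `|` range p.
Proof.
case=> i [j [-> ijp]] x; rewrite segmentE => -[[]->|/ijp]; last by left.
  by right; exists i.
by right; exists j.
Qed.

Lemma diagonal_meets_interior e :
  diagonal p e -> e `&` polygon_interior p !=set0.
Proof.
case=> i [j [-> ijp]]; have [x xij] := open_segment_nonempty (p i) (p j).
by exists x; split; [exact: open_segment_sub_segment|exact: ijp].
Qed.

Lemma noncrossingC d e : noncrossing p d e = noncrossing p e d.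
Proof. by rewrite /noncrossing setIC. Qed.

End Polygon.

Definition cut_interior {R : realType} {n : nat} (p : 'I_n -> 'rV[R]_2)
    (D : set (set 'rV[R]_2)) : set 'rV[R]_2 :=
  polygon_interior p `\` \bigcup_(d in D) d.

Lemma cut_interiorS (R : realType) n (p : 'I_n -> 'rV[R]_2) D E :
  D `<=` E -> cut_interior p E `<=` cut_interior p D.
Proof. by move=> DE; apply: setDS; exact: bigcup_subset. Qed.

Definition glue {T I : Type} (D : set T) (a : I -> set T) : set T :=
  D `|` \bigcup_i a i.

Definition restrict {R : realType} {I : Type} {m : I -> nat}
    (Q : forall i, 'I_(m i) -> 'rV[R]_2) (b : set (set 'rV[R]_2)) (i : I) :
    set (set 'rV[R]_2) :=
  b `&` diagonal (Q i).

Definition diagonal_family {R : realType} {I : Type} {m : I -> nat}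
    (Q : forall i, 'I_(m i) -> 'rV[R]_2) (a : I -> set (set 'rV[R]_2)) : Prop :=
  forall i, a i `<=` diagonal (Q i).

Section Division.
Context {R : realType} {n : nat} {p : 'I_n -> 'rV[R]_2}.
Context {D : set (set 'rV[R]_2)} {k : nat} {m : 'I_k -> nat}.
Context {Q : forall i, 'I_(m i) -> 'rV[R]_2}.
Arguments Q : clear implicits.
Hypothesis p_simple : simple_polygon p.
Hypothesis D_noncrossing : noncrossing_diagonals p D.
Hypothesis D_divides : divides p D Q.
Implicit Types (A d e : set 'rV[R]_2) (b : set (set 'rV[R]_2)).
Implicit Types a : 'I_k -> set (set 'rV[R]_2).

Lemma connected_component_piece i x : polygon_interior (Q i) x ->
  connected_component (cut_interior p D) x = polygon_interior (Q i).
Proof.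
case: D_divides => _ _ _ [/(_ i I)/= + _ _] => -[y _ <-].
by move/same_connected_component ->.
Qed.

Lemma piece_sub_cut_interior i : polygon_interior (Q i) `<=` cut_interior p D.
Proof.
move=> x ix; have := ix; rewrite -(connected_component_piece ix).
exact: connected_component_sub.
Qed.

Lemma cut_interior_piece x :
  cut_interior p D x -> exists i, polygon_interior (Q i) x.
Proof.
move=> Dx; case: D_divides => _ _ _ [_ _ pieces_surj].
have [|i _ iE] := pieces_surj (connected_component (cut_interior p D) x).
  by exists x.
by exists i; rewrite iE; exact: connected_component_refl.
Qed.

Lemma piece_disjoint i j x :
  polygon_interior (Q i) x -> polygon_interior (Q j) x -> i = j.
Proof.
move=> ix jx; case: D_divides => _ _ _ [_ pieces_inj _].
apply: pieces_inj; rewrite ?in_setE//=.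
by rewrite -(connected_component_piece ix) (connected_component_piece jx).
Qed.

Lemma connected_sub_piece A : connected A -> A !=set0 ->
  A `<=` cut_interior p D -> exists i, A `<=` polygon_interior (Q i).
Proof.
move=> Ac [x Ax] AD; have [i ix] := cut_interior_piece (AD x Ax).
exists i; rewrite -(connected_component_piece ix).
exact: connected_component_max.
Qed.

Lemma range_piece_sub i : range (Q i) `<=` range p.
Proof. by case: D_divides => _ Qp _ _ _ [j _ <-]; exact: Qp. Qed.

Lemma piece_interior_not_vertex i x : polygon_interior (Q i) x -> ~ range p x.
Proof. by move/piece_sub_cut_interior => -[/polygon_interior_not_vertex]. Qed.

Lemma piece_interior_diagonal_inj i j e x :
  polygon_interior (Q i) x -> diagonal (Q j) e -> e x -> i = j.
Proof.
move=> ix je /(diagonal_sub je)[jx|/range_piece_sub px].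
  exact: piece_disjoint ix jx.
by case: (piece_interior_not_vertex ix).
Qed.

Lemma piece_diagonal_inj i j e : diagonal (Q i) e -> diagonal (Q j) e -> i = j.
Proof.
move=> /diagonal_meets_interior[x [ex ix]] je.
exact: piece_interior_diagonal_inj ix je ex.
Qed.

Lemma piece_diagonal_notin i e : diagonal (Q i) e -> ~ D e.
Proof.
move=> /diagonal_meets_interior[x [ex /piece_sub_cut_interior[_ Dx]]] De.
by apply: Dx; exists e.
Qed.

Lemma piece_diagonal i e : diagonal (Q i) e -> diagonal p e.
Proof.
case=> j [l [-> jlQ]].
have [j' _ jE] : range p (Q i j) by apply: (@range_piece_sub i); exists j.
have [l' _ lE] : range p (Q i l) by apply: (@range_piece_sub i); exists l.
by exists j', l'; rewrite jE lE; split=> // x /jlQ/piece_sub_cut_interior[].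
Qed.

Lemma piece_noncrossing i d e :
  diagonal (Q i) d -> (noncrossing (Q i) d e <-> noncrossing p d e).
Proof.
move=> id; split=> de x dex; first exact/(@range_piece_sub i)/de.
have [ix|//] := diagonal_sub id dex.1.
by case: (piece_interior_not_vertex ix); exact: de.
Qed.

Lemma piece_diagonal_noncrossing_cut i d e :
  D d -> diagonal (Q i) e -> noncrossing p e d.
Proof.
move=> Dd ie; apply/(piece_noncrossing _ ie) => x [ex dx].
have [/piece_sub_cut_interior[_ []]|//] := diagonal_sub ie ex.
by exists d.
Qed.

Lemma distinct_pieces_noncrossing i j d e : i != j ->
  diagonal (Q i) d -> diagonal (Q j) e -> noncrossing p d e.
Proof.
move=> ij id je; apply/(piece_noncrossing _ id) => x [dx ex].
have [ix|//] := diagonal_sub id dx.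
by rewrite (piece_interior_diagonal_inj ix je ex) eqxx in ij.
Qed.

Lemma glueK a : diagonal_family Q a -> restrict Q (glue D a) = a.
Proof.
move=> aQ; apply/funext => i; apply/seteqP; split=> e.
  case=> -[De|[j _ je]] ie; first by case: (piece_diagonal_notin ie).
  by rewrite (piece_diagonal_inj ie (aQ _ _ je)).
by move=> ie; split; [right; exists i|exact: aQ].
Qed.

Lemma glue_subset a a' :
  diagonal_family Q a -> diagonal_family Q a' ->
  glue D a `<=` glue D a' <-> forall i, a i `<=` a' i.
Proof.
move=> aQ a'Q; split=> [gaa' i|aa'].
  by rewrite -(glueK aQ) -(glueK a'Q); exact: setSI.
by apply: setUS; apply: subset_bigcup => i _; exact: aa'.
Qed.

Lemma cut_interior_glue a i : diagonal_family Q a ->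
  cut_interior p (glue D a) `&` polygon_interior (Q i) =
  cut_interior (Q i) (a i).
Proof.
move=> aQ; apply/seteqP; split=> x.
  move=> [[_ gx] ix]; split=> // -[e ie ex]; apply: gx; exists e => //.
  by right; exists i.
case=> ix ax; have [px Dx] := piece_sub_cut_interior ix; split=> //; split=> //.
case=> e [De|[j _ je]] ex; first by apply: Dx; exists e.
apply: ax; exists e => //.
by rewrite (piece_interior_diagonal_inj ix (aQ _ _ je) ex).
Qed.

Lemma connected_component_glue a i x : diagonal_family Q a ->
  polygon_interior (Q i) x ->
  connected_component (cut_interior p (glue D a)) x =
  connected_component (cut_interior (Q i) (a i)) x.
Proof.
move=> aQ ix; rewrite -(cut_interior_glue i aQ) -(connected_component_piece ix).
by rewrite connected_componentI//; exact/cut_interiorS/subsetUl.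
Qed.

Lemma pieces_glue a : diagonal_family Q a ->
  pieces p (glue D a) = \bigcup_i pieces (Q i) (a i).
Proof.
move=> aQ; apply/seteqP; split=> C.
  case=> x gx <-.
  have [i ix] := cut_interior_piece (cut_interiorS (@subsetUl _ _ _) gx).
  have ax : cut_interior (Q i) (a i) x by rewrite -cut_interior_glue.
  by exists i => //; exists x; rewrite // (connected_component_glue aQ ix).
case=> i _ [x ax <-].
have [gx _] : (cut_interior p (glue D a) `&` polygon_interior (Q i)) x.
  by rewrite cut_interior_glue.
by exists x; rewrite // (connected_component_glue aQ ax.1).
Qed.

Lemma noncrossing_glue a : diagonal_family Q a ->
  noncrossing_diagonals p (glue D a) <->
  forall i, noncrossing_diagonals (Q i) (a i).
Proof.
move=> aQ; split=> [[_ g_noncrossing] i|a_noncrossing].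
  split=> [|d e id ie de]; first exact: aQ.
  by apply/(piece_noncrossing _ (aQ _ _ id)); apply: g_noncrossing => //;
    right; exists i.
split=> [e [/D_noncrossing.1//|[i _ /aQ]]|d e]; first exact: piece_diagonal.
move=> [Dd|[i _ id]] [De|[j _ je]] de.
- exact: D_noncrossing.2.
- rewrite noncrossingC.
  exact: piece_diagonal_noncrossing_cut Dd (aQ _ _ je).
- exact: piece_diagonal_noncrossing_cut De (aQ _ _ id).
- have [ij|ij] := eqVneq i j; last first.
    exact: distinct_pieces_noncrossing ij (aQ _ _ id) (aQ _ _ je).
  rewrite -ij in je; apply/(piece_noncrossing _ (aQ _ _ id)).
  exact: (a_noncrossing i).2.
Qed.

Lemma convex_diagonalization_glue a : diagonal_family Q a ->
  convex_diagonalization p (glue D a) <->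
  forall i, convex_diagonalization (Q i) (a i).
Proof.
move=> aQ; rewrite /convex_diagonalization pieces_glue//.
split=> [[/(noncrossing_glue aQ) aN aC] i|aNC].
  by split=> // C iC; apply: aC; exists i.
split; first by apply/(noncrossing_glue aQ) => i; have [] := aNC i.
by move=> C [i _ iC]; exact: (aNC i).2.
Qed.

Lemma piece_boundary_vertex i l : boundary (Q i) (p l) -> range (Q i) (p l).
Proof.
case=> j _ jl; suff [->|->] : [set Q i j; Q i (ordS j)] (p l).
- by exists j.
- by exists (ordS j).
case: D_divides => _ _ /(_ i j)[[h _ hE]|Dij] _; last first.
  have [h [h' [hE hh'p]]] := D_noncrossing.1 _ Dij.
  by rewrite (segment_eq_endpoints hE); apply: diagonal_vertex; rewrite // -hE.
by rewrite -(segment_eq_endpoints hE); apply: edge_vertex; rewrite // hE.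
Qed.

Lemma open_segment_piece_vertex i l y :
  open_segment (p l) y `<=` polygon_interior (Q i) -> range (Q i) (p l).
Proof.
move=> /open_segment_interior_left[il|]; last exact: piece_boundary_vertex.
by case: (piece_interior_not_vertex il); exists l.
Qed.

Lemma diagonal_in_piece e : diagonal p e ->
  (forall d, D d -> noncrossing p e d) -> exists i, diagonal (Q i) e.
Proof.
case=> j [l [-> jlp]] jlD.
have jl_cut : open_segment (p j) (p l) `<=` cut_interior p D.
  move=> x jlx; split=> [|[d Dd dx]]; first exact: jlp.
  apply: (polygon_interior_not_vertex (jlp _ jlx)).
  apply: (jlD d Dd); split=> //; exact: open_segment_sub_segment.
have [i jlQ] := connected_sub_piece (@connected_open_segment _ (p j) (p l))
  (open_segment_nonempty _ _) jl_cut.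
have [j' _ jE] := open_segment_piece_vertex jlQ.
rewrite open_segmentC in jlQ; have [l' _ lE] := open_segment_piece_vertex jlQ.
by exists i, j', l'; rewrite jE lE open_segmentC.
Qed.

Lemma restrictK b : noncrossing_diagonals p b -> D `<=` b ->
  glue D (restrict Q b) = b.
Proof.
move=> [b_diagonal b_noncrossing] Db; apply/seteqP; split=> e.
  by case=> [/Db//|[i _ []]].
move=> be; have [|De] := pselect (D e); [by left|right].
have [d Dd|i ie] := diagonal_in_piece (b_diagonal e be); last by exists i.
by apply: b_noncrossing => //; [exact: Db|move=> ed; rewrite ed in De].
Qed.

Lemma convex_diagonalization_restrict b : convex_diagonalization p b ->
  D `<=` b -> forall i, convex_diagonalization (Q i) (restrict Q b i).
Proof.
move=> b_conv Db; apply/convex_diagonalization_glue => [i|].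
  exact: subIsetr.
by rewrite restrictK//; exact: b_conv.1.
Qed.

End Division.

Lemma polytope_nonempty (R : realType) N (X : set 'rV[R]_N) :
  polytope X -> X !=set0.
Proof.
case=> n [v ->]; exists (v ord0); exists (fun j => (j == ord0)%:R); split.
- by move=> j; rewrite ler0n.
- by under eq_bigr do rewrite mulrb; rewrite -big_mkcond big_pred1_eq.
- under eq_bigr do rewrite scaler_nat mulrb.
  by rewrite -big_mkcond big_pred1_eq.
Qed.

Definition box {I : Type} {T : I -> Type} (F : forall i, set (T i)) :
    set (forall i, T i) :=
  [set x | forall i, F i (x i)].

Lemma box_subset (I : eqType) (T : I -> Type) (F G : forall i, set (T i)) :
  (forall i, F i !=set0) -> box F `<=` box G <-> forall i, F i `<=` G i.
Proof.
move=> F0; split=> [FG i y Fy|FG x Fx i]; last exact: FG.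
have [x Fx] : {x | box F x}.
  by exists (fun i => sval (cid (F0 i))) => j; exact: svalP (cid (F0 j)).
have : box G (dfwith x i y) by apply: FG => j; case: dfwithP.
by move=> /(_ i); rewrite dfwithin.
Qed.

Lemma isomorphic_complexes_of_correspondence (T U : Type) (K : set (set T))
    (L : set (set U)) (r : set T -> set U -> Prop) :
  (forall F, K F -> exists2 X, L X & r F X) ->
  (forall X, L X -> exists2 F, K F & r F X) ->
  (forall F G X Y, K F -> K G -> r F X -> r G Y -> (F `<=` G <-> X `<=` Y)) ->
  isomorphic_complexes K L.
Proof.
move=> r_total r_surj r_le.
have /choice[f fP] F : exists X, K F -> L X /\ r F X.
  by have [/r_total[X LX rFX]|] := pselect (K F); [exists X|exists set0].
have f_le F G : K F -> K G -> (F `<=` G <-> f F `<=` f G).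
  by move=> KF KG; apply: r_le => //; [exact: (fP F KF).2|exact: (fP G KG).2].
exists f; split=> //; split=> [F /fP[]//|F G /set_mem KF /set_mem KG FG|X LX].
  by apply/seteqP; split; apply/f_le; rewrite // FG.
have [F KF rFX] := r_surj X LX; have [_ rFf] := fP F KF; exists F => //.
by apply/seteqP; split; [exact/(r_le F F _ _ KF KF rFf rFX)|
                         exact/(r_le F F _ _ KF KF rFX rFf)].
Qed.

Section DiagonalizationComplex.
Context {R : realType} {n : nat} {p : 'I_n -> 'rV[R]_2} {N : nat}.
Context {K : set (set 'rV[R]_N)} {lab : set 'rV[R]_N -> set (set 'rV[R]_2)}.
Hypothesis K_complex : diagonalization_complex p K lab.
Implicit Types F : set 'rV[R]_N.

Lemma face_nonempty F : K F -> F !=set0.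
Proof.
by case: K_complex => -[_ K_polytope _ _] _ _ /K_polytope/polytope_nonempty.
Qed.

Lemma face_label_convex F : K F -> convex_diagonalization p (lab F).
Proof. by case: K_complex => _ [+ _ _] _; apply. Qed.

Lemma face_label_diagonal F : K F -> lab F `<=` diagonal p.
Proof. by move/face_label_convex => -[[]]. Qed.

Lemma face_label_surj a :
  convex_diagonalization p a -> exists2 F, K F & lab F = a.
Proof. by case: K_complex => _ [_ _ +] _; apply. Qed.

Lemma face_subset F G : K F -> K G -> F `<=` G <-> lab G `<=` lab F.
Proof. by case: K_complex => _ _; apply. Qed.

End DiagonalizationComplex.

Section ProductComplex.
Context {R : realType} {k : nat} {m : 'I_k -> nat} {N : 'I_k -> nat}.
Variable Q : forall i, 'I_(m i) -> 'rV[R]_2.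
Arguments Q : clear implicits.
Variable K : forall i, set (set 'rV[R]_(N i)).
Arguments K : clear implicits.
Variable lab : forall i, set 'rV[R]_(N i) -> set (set 'rV[R]_2).
Arguments lab : clear implicits.
Hypothesis K_complex : forall i, diagonalization_complex (Q i) (K i) (lab i).

Lemma product_label_surj a : (forall i, convex_diagonalization (Q i) (a i)) ->
  exists2 F, forall i, K i (F i) & (fun i => lab i (F i)) = a.
Proof.
move=> a_conv.
have face i := cid2 (face_label_surj (K_complex i) (a_conv i)).
exists (fun i => s2val (face i)) => [i|]; first exact: s2valP (face i).
by apply/funext => i; exact: s2valP' (face i).
Qed.

Lemma product_face_subset F G :
  (forall i, K i (F i)) -> (forall i, K i (G i)) ->
  box F `<=` box G <-> forall i, lab i (G i) `<=` lab i (F i).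
Proof.
move=> KF KG; rewrite box_subset => [|i]; last exact: face_nonempty (KF i).
by split=> FG i; apply/(face_subset (K_complex i)).
Qed.

End ProductComplex.

Theorem theorem2p3 (R : realType)
    (n : nat) (p : 'I_n -> 'rV[R]_2)
    (k : nat) (d : 'I_k -> set 'rV[R]_2)
    (m : 'I_k.+1 -> nat) (Q : forall i : 'I_k.+1, 'I_(m i) -> 'rV[R]_2)
    (NP : nat) (KP : set (set 'rV[R]_NP))
    (labP : set 'rV[R]_NP -> set (set 'rV[R]_2))
    (N : 'I_k.+1 -> nat) (K : forall i : 'I_k.+1, set (set 'rV[R]_(N i)))
    (lab : forall i : 'I_k.+1, set 'rV[R]_(N i) -> set (set 'rV[R]_2))
    (p_simple : simple_polygon p) (p_general : general_position p)
    (d_inj : injective d) (d_noncrossing : noncrossing_diagonals p (range d))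
    (d_divides : divides p (range d) Q)
    (KP_complex : diagonalization_complex p KP labP)
    (K_complex : forall i : 'I_k.+1, diagonalization_complex (Q i) (K i) (lab i)) :
  isomorphic_complexes (faces_containing KP labP (range d)) (product_complex K).
Proof.
pose labels (F : forall i, set 'rV[R]_(N i)) i := lab i (F i).
have labels_diagonal F : (forall i, K i (F i)) -> diagonal_family Q (labels F).
  by move=> KF i; exact: face_label_diagonal (KF i).
apply: (isomorphic_complexes_of_correspondence (r := fun G X => exists F,
  [/\ forall i, K i (F i), X = box F & labP G = glue (range d) (labels F)])).
- move=> G [KG dG]; have G_conv := face_label_convex KP_complex KG.
  have G_restrict_conv := convex_diagonalization_restrict p_simple
    d_noncrossing d_divides G_conv dG.
  have [F KF FE] := product_label_surj K_complex G_restrict_conv.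
  exists (box F); exists F; split=> //.
  rewrite /labels FE (restrictK p_simple d_noncrossing d_divides)//.
  exact: G_conv.1.
- move=> X [F [KF ->]]; have [|G KG GE] := face_label_surj KP_complex
    (a := glue (range d) (labels F)).
    apply/(convex_diagonalization_glue d_noncrossing d_divides) => // i.
      exact: labels_diagonal.
    exact: face_label_convex (KF i).
  by exists G; [split; rewrite // GE; exact: subsetUl|exists F].
- move=> G G' _ _ [KG _] [KG' _] [F [KF -> GE]] [F' [KF' -> G'E]].
  have FQ := labels_diagonal F KF; have F'Q := labels_diagonal F' KF'.
  rewrite (face_subset KP_complex)// GE G'E (glue_subset d_divides F'Q FQ).
  exact: iff_sym (product_face_subset K_complex KF KF').
Qed.
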